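(* Let $\mathcal B$ be a set and $N:\mathcal B\times\mathcal B\to\mathbb Z_+$ an arbitrary function (not necessarily constant or symmetric). Let $C=C(N)$ be the free associative conformal algebra generated by $\mathcal B$ corresponding to the locality function $N$, let $A=\operatorname{Coeff}C(N)$ be its coefficient algebra, and $A_+\subset A$ its positive subalgebra. (a) A basis of the algebra $A$ is given by all monomials of the form $$a_1(n_1)\cdots a_{l-1}(n_{l-1})\,a_l(n_l),\qquad l\ge1,$$ where $a_i\in\mathcal B$, $n_i\in\mathbb Z$ and $$-\left\lceil\frac{N_i-1}2\right\rceil\le n_i\le\left\lfloor\frac{N_i-1}2\right\rfloor,\qquad N_i=N(a_i,a_{i+1}),\qquad\text{for } i=1,\dots,l-1$$ (with $n_l\in\mathbb Z$ arbitrary). (b) A basis of the algebra $A_+$ is given by all monomials of the form $$a_1(n_1)\cdots a_{l-1}(n_{l-1})\,a_l(n_l),\qquad l\ge1,$$ where $a_i\in\mathcal B$, $n_i\in\mathbb Z$ and $$0\le n_i\le N_i-1,\qquad N_i=N(a_i,a_{i+1}),\qquad\text{for } i=1,\dots,l-1$$ (with $n_l\ge0$ arbitrary).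
   Context: All spaces are over a field $\Bbbk$ of characteristic $0$; $\mathbb Z_+$ is the set of non-negative integers. Associative algebras here need not have an identity. $A=\operatorname{Coeff}C(N)$ is the associative (non-unital) algebra presented by the generators $X=\{b(n)\mid b\in\mathcal B,\ n\in\mathbb Z\}$ and the relations $$\sum_{s=0}^{N(b,a)}(-1)^s\binom{N(b,a)}s\,b(n-s)\,a(m+s)=0\qquad(a,b\in\mathcal B,\ m,n\in\mathbb Z).$$ For $b\in\mathcal B$ put $\tilde b=\sum_{n\in\mathbb Z}b(n)z^{-n-1}\in A[[z,z^{-1}]]$. On $A[[z,z^{-1}]]$ consider $D=d/dz$ and, for $n\in\mathbb Z_+$, the circle products $(a\circ_nb)(m)=\sum_{s=0}^n(-1)^s\binom ns a(n-s)b(m+s)$, where $a(z)=\sum_n a(n)z^{-n-1}$. The free associative conformal algebra $C=C(N)\subset A[[z,z^{-1}]]$ is the smallest linear subspace containing all $\tilde b$ and closed under $D$ and all $\circ_n$. The positive subalgebra is $A_+=\operatorname{Span}\{c(n)\mid c\in C,\ n\ge0\}\subset A$. *)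

(* Defs.v *)
From HB Require Import structures.
From mathcomp Require Import all_boot all_order all_algebra.
From mathcomp Require finmap.
From mathcomp Require Import generic_quotient ring_quotient.
From mathcomp Require Import boolp classical_sets functions.
From mathcomp.multinomials Require Import monalg.

Set Implicit Arguments.
Unset Strict Implicit.
Unset Printing Implicit Defensive.

Import Order.TTheory GRing.Theory Num.Theory.
Local Open Scope ring_scope.
Local Open Scope quotient_scope.
Local Open Scope classical_set_scope.

Reserved Notation "x ** y" (at level 40, left associativity).

(* Associative algebras without a unit: rings in ssralg are all unital. *)
HB.mixin Record Lmodule_isNualgebra (k : fieldType) A of GRing.Lmodule k A := {
  numul : A -> A -> A;
  numulA : associative numul;
  numulDl : left_distributive numul +%R;
  numulDr : right_distributive numul +%R;
  nuscaleAl : forall (c : k) (x y : A), c *: numul x y = numul (c *: x) y;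
  nuscaleAr : forall (c : k) (x y : A), c *: numul x y = numul x (c *: y)
}.

#[short(type="nualgType")]
HB.structure Definition Nualgebra (k : fieldType) :=
  {A of GRing.Lmodule k A & Lmodule_isNualgebra k A}.

Notation "x ** y" := (numul x y) : ring_scope.

Section LinearAlgebra.
Variables (k : fieldType) (V : lmodType k).

Definition is_subspace (S : set V) : Prop :=
  S 0 /\ forall (c : k) (x y : V), S x -> S y -> S (c *: x + y).

Definition linear_span (S : set V) : set V :=
  [set x | exists s : seq (k * V),
     (forall p, p \in s -> S p.2) /\ x = \sum_(p <- s) p.1 *: p.2].

(* The elements e i, for i satisfying P, are pairwise distinct and form a
   basis of the subspace U of V. *)
Definition is_basis (U : set V) (I : choiceType) (P : pred I) (e : I -> V) :
    Prop :=
  U = linear_span (e @` [set i | P i]) /\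
  forall (s : seq I) (c : I -> k), uniq s -> all P s ->
    \sum_(i <- s) c i *: e i = 0 -> forall i, i \in s -> c i = 0.

End LinearAlgebra.

(* The free non-unital algebra on X is realized as the augmentation ideal of
   the unital algebra of noncommutative polynomials in X. *)
Section FreeNonunital.
Variables (k : fieldType) (X : choiceType).

Local Notation kX := {malg k[{fmonom X}]}.

Definition augmentation : {pred kX} := fun x => x@_(mone : {fmonom X}) == 0.

Fact augmentation_subsemimod : subsemimod_closed augmentation.
Proof.
split; first split.
- by rewrite unfold_in mcoeff0.
- by move=> x y; rewrite !unfold_in mcoeffD => /eqP-> /eqP->; rewrite addr0.
- by move=> c x; rewrite !unfold_in mcoeffZ => /eqP->; rewrite mulr0.
Qed.

HB.instance Definition _ :=
  GRing.isSubmodClosed.Build k kX augmentation augmentation_subsemimod.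

Record free_nualg : predArgType :=
  FreeNualg { free_val : kX; _ : free_val \in augmentation }.

HB.instance Definition _ := [isSub for free_val].
HB.instance Definition _ := [Choice of free_nualg by <:].
HB.instance Definition _ := [SubChoice_isSubLmodule of free_nualg by <:].

Fact augmentationMl (x y : kX) : x \in augmentation -> x * y \in augmentation.
Proof. by rewrite !unfold_in rmorphM /= => /eqP->; rewrite mul0r. Qed.

Definition free_mul (x y : free_nualg) : free_nualg :=
  FreeNualg (augmentationMl (free_val y) (valP x)).

Fact malg_scaleAr (c : k) (x y : kX) : c *: (x * y) = x * (c *: y).
Proof.
rewrite (malgMEw (finmap.fsubset_refl _) (msuppZ_le c y)) malgME raddf_sum /=.
apply: eq_bigr => u _; rewrite raddf_sum /=; apply: eq_bigr => v _.
by apply/malgP => w; rewrite mcoeffZ !mcoeffU mcoeffZ mulrCA mulrnAr.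
Qed.

Fact free_mulA : associative free_mul.
Proof. by move=> x y z; apply: val_inj; rewrite /= mulrA. Qed.

Fact free_mulDl : left_distributive free_mul +%R.
Proof. by move=> x y z; apply: val_inj; rewrite /= mulrDl. Qed.

Fact free_mulDr : right_distributive free_mul +%R.
Proof. by move=> x y z; apply: val_inj; rewrite /= mulrDr. Qed.

Fact free_scaleAl (c : k) (x y : free_nualg) :
  c *: free_mul x y = free_mul (c *: x) y.
Proof. by apply: val_inj; rewrite /= scalerAl. Qed.

Fact free_scaleAr (c : k) (x y : free_nualg) :
  c *: free_mul x y = free_mul x (c *: y).
Proof. by apply: val_inj; rewrite /= malg_scaleAr. Qed.

HB.instance Definition _ := Lmodule_isNualgebra.Build k free_nualg
  free_mulA free_mulDl free_mulDr free_scaleAl free_scaleAr.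

Fact augmentationU (x : X) : (<< fmu x >> : kX) \in augmentation.
Proof.
rewrite unfold_in mcoeffU; case: (fmu x =P mone) => h; last exact: eqxx.
by have := congr1 (@fmonom_val X) h; rewrite fmuE fm1.
Qed.

Definition free_gen (x : X) : free_nualg := FreeNualg (augmentationU x).

End FreeNonunital.

Section QuotientNonunital.
Variables (k : fieldType) (A : nualgType k) (R : set A).

Definition is_ideal (S : set A) : Prop :=
  is_subspace S /\ forall a x : A, S x -> S (a ** x) /\ S (x ** a).

Definition gen_ideal : set A := smallest is_ideal R.

Fact gen_ideal_is_ideal : is_ideal gen_ideal.
Proof.
split; first split.
- by move=> S [[[S0 _] _] _].
- move=> c x y xI yI S SP; have [[[_ Slin] _] _] := SP.
  by apply: Slin; [apply: xI | apply: yI].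
- move=> a x xI; split=> S SP; have [[_ SM] _] := SP;
    by have [] := SM a x (xI _ SP).
Qed.

Definition in_gen_ideal : {pred A} := fun x => `[< gen_ideal x >].

Fact in_gen_ideal_zmod : zmod_closed in_gen_ideal.
Proof.
have [[I0 Ilin] _] := gen_ideal_is_ideal.
split=> [|x y]; first exact/asboolP.
move=> /asboolP xI /asboolP yI; apply/asboolP.
by rewrite addrC -scaleN1r; apply: Ilin.
Qed.

HB.instance Definition _ :=
  GRing.isZmodClosed.Build A in_gen_ideal in_gen_ideal_zmod.

Definition quot_nualg := Quotient.quot (in_gen_ideal : zmodClosed A).

HB.instance Definition _ := GRing.Zmodule.on quot_nualg.
HB.instance Definition _ := EqQuotient.on quot_nualg.

Local Notation Q := quot_nualg.

Definition quot_pi (x : A) : Q := \pi_Q x.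

Definition quot_scale (c : k) (x : Q) : Q := quot_pi (c *: repr x).

Definition quot_mul (x y : Q) : Q := quot_pi (repr x ** repr y).

Fact quot_piP (x y : A) : quot_pi x = quot_pi y <-> gen_ideal (x - y).
Proof.
split=> [/eqP|xyI].
  by rewrite /quot_pi -Quotient.idealrBE => /asboolP.
by apply/eqP; rewrite /quot_pi -Quotient.idealrBE; apply/asboolP.
Qed.

Fact quot_piD (x y : A) : quot_pi (x + y) = quot_pi x + quot_pi y.
Proof. by rewrite /quot_pi !piE. Qed.

Fact quot_reprP (x : A) : gen_ideal (x - repr (quot_pi x)).
Proof. by apply/quot_piP; rewrite /quot_pi reprK. Qed.

Fact quot_piZ (c : k) (x : A) : quot_pi (c *: x) = quot_scale c (quot_pi x).
Proof.
apply/quot_piP; rewrite -scalerBr -[_ *: _]addr0.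
by have [[I0 Ilin] _] := gen_ideal_is_ideal; apply: Ilin (quot_reprP x) I0.
Qed.

Fact quot_piM (x y : A) : quot_pi (x ** y) = quot_mul (quot_pi x) (quot_pi y).
Proof.
apply/quot_piP; set x' := repr _; set y' := repr _.
have [[_ Ilin] IM] := gen_ideal_is_ideal.
have -> : x ** y - x' ** y' = 1 *: ((x - x') ** y) + x' ** (y - y').
  rewrite scale1r numulDl numulDr addrA -!scaleN1r -nuscaleAl -nuscaleAr.
  by rewrite -[_ + _ + x' ** y]addrA [_ + x' ** y]addrC !scaleN1r subrr addr0.
by apply: Ilin; [have [] := IM y _ (quot_reprP x)
                | have [] := IM x' _ (quot_reprP y)].
Qed.

Fact quot_piK (x : Q) : exists y, x = quot_pi y.
Proof. by exists (repr x); rewrite /quot_pi reprK. Qed.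

Fact quot_scaleA (a b : k) (x : Q) :
  quot_scale a (quot_scale b x) = quot_scale (a * b) x.
Proof. by have [y ->] := quot_piK x; rewrite -!quot_piZ scalerA. Qed.

Fact quot_scale1 : left_id 1 quot_scale.
Proof. by move=> x; have [y ->] := quot_piK x; rewrite -quot_piZ scale1r. Qed.

Fact quot_scaleDr : right_distributive quot_scale +%R.
Proof.
move=> c x y; have [x' ->] := quot_piK x; have [y' ->] := quot_piK y.
by rewrite -quot_piD -!quot_piZ scalerDr quot_piD.
Qed.

Fact quot_scaleDl (x : Q) : {morph quot_scale^~ x : a b / a + b}.
Proof.
by move=> a b; have [y ->] := quot_piK x; rewrite -!quot_piZ scalerDl quot_piD.
Qed.

HB.instance Definition _ := GRing.Zmodule_isLmodule.Build k Q
  quot_scaleA quot_scale1 quot_scaleDr quot_scaleDl.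

Fact quot_mulA : associative quot_mul.
Proof.
move=> x y z; have [x' ->] := quot_piK x; have [y' ->] := quot_piK y.
by have [z' ->] := quot_piK z; rewrite -!quot_piM numulA.
Qed.

Fact quot_mulDl : left_distributive quot_mul +%R.
Proof.
move=> x y z; have [x' ->] := quot_piK x; have [y' ->] := quot_piK y.
by have [z' ->] := quot_piK z; rewrite -quot_piD -!quot_piM numulDl quot_piD.
Qed.

Fact quot_mulDr : right_distributive quot_mul +%R.
Proof.
move=> x y z; have [x' ->] := quot_piK x; have [y' ->] := quot_piK y.
by have [z' ->] := quot_piK z; rewrite -quot_piD -!quot_piM numulDr quot_piD.
Qed.

Fact quot_scaleAl (c : k) (x y : Q) :
  c *: quot_mul x y = quot_mul (c *: x) y.
Proof.
have [x' ->] := quot_piK x; have [y' ->] := quot_piK y.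
by rewrite /GRing.scale /= -quot_piM -!quot_piZ -quot_piM nuscaleAl.
Qed.

Fact quot_scaleAr (c : k) (x y : Q) :
  c *: quot_mul x y = quot_mul x (c *: y).
Proof.
have [x' ->] := quot_piK x; have [y' ->] := quot_piK y.
by rewrite /GRing.scale /= -quot_piM -!quot_piZ -quot_piM nuscaleAr.
Qed.

HB.instance Definition _ := Lmodule_isNualgebra.Build k Q
  quot_mulA quot_mulDl quot_mulDr quot_scaleAl quot_scaleAr.

End QuotientNonunital.

(* The formal distribution \sum_n a(n) z^(-n-1) in A[[z, z^-1]] is the function
   n |-> a(n), with the pointwise linear structure. *)
Section FormalDistributions.
Variables (k : fieldType) (A : nualgType k).

(* d/dz \sum_n a(n) z^(-n-1) = \sum_n (- n - 1) a(n) z^(-n-2) *)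
Definition fd_deriv (a : int -> A) : int -> A :=
  fun m => a (m - 1) *~ (- m).

Definition circ (n : nat) (a b : int -> A) : int -> A :=
  fun m => \sum_(s < n.+1)
    ((-1) ^+ s * 'C(n, s)%:R : k) *: (a (n%:Z - s%:Z) ** b (m + s%:Z)).

Definition conformal_closed (S : set (int -> A)) : Prop :=
  [/\ is_subspace S,
      forall a, S a -> S (fd_deriv a)
    & forall n a b, S a -> S b -> S (circ n a b)].

End FormalDistributions.

Section FreeConformal.
Variables (k : fieldType) (B : choiceType) (N : B -> B -> nat).

Definition locality_rel (b a : B) (m n : int) : free_nualg k (B * int)%type :=
  \sum_(s < (N b a).+1) ((-1) ^+ s * 'C(N b a, s)%:R : k) *:
    (free_gen k (b, n - s%:Z) ** free_gen k (a, m + s%:Z)).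

Definition locality_rels : set (free_nualg k (B * int)%type) :=
  [set x | exists b a m n, x = locality_rel b a m n].

Definition Coeff : Type := quot_nualg locality_rels.

HB.instance Definition _ := Nualgebra.on Coeff.

(* The generator b(n), indexed by the letter (b, n). *)
Definition gen (x : B * int) : Coeff := quot_pi locality_rels (free_gen k x).

Definition gen_series (b : B) : int -> Coeff := fun n => gen (b, n).

Definition free_conformal : set (int -> Coeff) :=
  smallest (@conformal_closed k Coeff) (range gen_series).

Definition Coeff_pos : set Coeff :=
  linear_span [set x | exists (c : int -> Coeff) (n : int),
    [/\ free_conformal c, 0 <= n & x = c n]].

(* The pair (x, s) stands for the nonempty word x :: s. *)
Definition monomial (w : (B * int) * seq (B * int)) : Coeff :=
  foldl (fun p x => p ** gen x) (gen w.1) w.2.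

Definition balanced_word (w : (B * int) * seq (B * int)) : bool :=
  path (fun x y : B * int =>
    let r : rat := ((N x.1 y.1)%:R - 1) / 2 in
    - Num.ceil r <= x.2 <= Num.floor r) w.1 w.2.

Definition positive_word (w : (B * int) * seq (B * int)) : bool :=
  path (fun x y : B * int => 0 <= x.2 <= (N x.1 y.1)%:Z - 1) w.1 w.2
  && (0 <= (last w.1 w.2).2).

End FreeConformal.

Arguments gen k {B} N x.
Arguments gen_series k {B} N b.
Arguments free_conformal k {B} N.
Arguments Coeff_pos k {B} N.
Arguments monomial k {B} N w.

(* Main.v *)
Require Import Defs.
From mathcomp Require Import all_boot all_order all_algebra.
From mathcomp Require Import boolp classical_sets functions.
From mathcomp Require finmap.
From mathcomp.multinomials Require Import monalg.
From mathcomp Require Import zify ring lra.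

Set Implicit Arguments.
Unset Strict Implicit.
Unset Printing Implicit Defensive.

Import Order.TTheory GRing.Theory Num.Theory.
Local Open Scope ring_scope.
Local Open Scope classical_set_scope.

(* On words with letters a_1, ..., a_l, the algebra A is the quotient of the
   Laurent polynomials in x_1, ..., x_l, where x_i raises the i-th index, by the
   ideal generated by the (x_i - x_{i+1})^{N_i}.  This polynomial is monic in
   x_i with constant term a unit times a power of x_{i+1}, so reduction confines
   n_i to any window of N_i consecutive integers; for the window [0, N_i) the
   reduction uses nonnegative exponents only.
   For independence, put p_i = n_1 + ... + n_i.  Shifting (n_i, n_{i+1}) to
   (n_i - s, n_{i+1} + s) changes only p_i, so the i-th relation annihilates
   every functional f(p_1, ..., p_l) that is polynomial of degree < N_i in p_i.
   Products of Lagrange polynomials at the nodes of the windows separate the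
   normal words. *)

(** The sum is an [N]-th backward difference, applied to a polynomial of degree [size L < N]. *)
Lemma binomial_diff_prod (R : comNzRingType) (L : seq int) (N : nat) (x : int) :
  (size L < N)%N ->
  \sum_(s < N.+1) ((-1) ^+ s * 'C(N, s)%:R) *
    \prod_(j <- L) (x - s%:Z - j)%:~R = 0 :> R.
Proof.
elim: L N x => [|v L IH] N x.
  case: N => // N _; transitivity ((1 - 1 : R) ^+ N.+1).
    rewrite exprBn_comm; last exact: commr1.
    by apply: eq_bigr => s _; rewrite big_nil !expr1n !mulr1 mulr_natr.
  by rewrite subrr expr0n.
case: N => // N; rewrite ltnS => szL.
(* As s * 'C(N.+1, s) = N.+1 * 'C(N, s.-1), the factor x - s - v lowers the
   order of the difference by at most one. *)
have key : forall s : 'I_N.+2,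
    ((-1) ^+ s * 'C(N.+1, s)%:R) * \prod_(j <- v :: L) (x - s%:Z - j)%:~R =
    (x - v)%:~R * (((-1) ^+ s * 'C(N.+1, s)%:R) *
                   \prod_(j <- L) (x - s%:Z - j)%:~R)
    - ((-1) ^+ s * (s * 'C(N.+1, s))%:R) *
       \prod_(j <- L) (x - s%:Z - j)%:~R :> R.
  move=> s; rewrite big_cons; set p := \prod_(j <- L) _.
  by rewrite natrM !rmorphB /= -!pmulrn; ring.
rewrite (eq_bigr _ (fun s _ => key s)) sumrB -mulr_sumr.
rewrite IH ?ltnS ?(ltnW szL) // mulr0 sub0r.
rewrite big_ord_recl /= mul0n mulr0 mul0r add0r.
apply/eqP; rewrite oppr_eq0; apply/eqP.
(* Shifting the summation index by one replaces [x] by [x - 1] and leaves a difference of order [N]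
   over [L]. *)
transitivity (- N.+1%:R * \sum_(s < N.+1) ((-1) ^+ s * 'C(N, s)%:R) *
    \prod_(j <- L) ((x - 1) - s%:Z - j)%:~R : R); last by rewrite IH ?mulr0.
rewrite mulr_sumr; apply: eq_bigr => s _.
rewrite /bump /= add1n -mul_bin_diag natrM exprS.
rewrite (eq_bigr (fun j => (x - 1 - s%:Z - j)%:~R)); first ring.
by move=> j _; congr (_%:~R); lia.
Qed.

(** * Functionals that separate normal words *)

Section SeparatingFunctional.
Variables (k : fieldType) (B : choiceType) (N : B -> B -> nat).
Variable lo : B -> B -> int.

Definition window (x y : B) : seq int :=
  [seq lo x y + i%:Z | i <- iota 0 (N x y)].

Definition in_window (x y : B * int) : bool := x.2 \in window x.1 y.1.

Lemma in_windowE x y :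
  in_window x y = (lo x.1 y.1 <= x.2 < lo x.1 y.1 + (N x.1 y.1)%:Z).
Proof.
apply/mapP/idP => [[i]|xin]; first by rewrite mem_iota; lia.
by exists `|x.2 - lo x.1 y.1|%N; rewrite ?mem_iota; lia.
Qed.

Lemma window_uniq x y : uniq (window x y).
Proof. by rewrite map_inj_uniq ?iota_uniq // => i j; lia. Qed.

(* [window_poly x w t] is, up to a scalar, the Lagrange polynomial of the
   window of the letter [x] followed by the word [w], at the node [x.2]. *)
Definition window_poly (x : B * int) (w : seq (B * int)) (t : int) : k :=
  if w is y :: _ then \prod_(j <- rem x.2 (window x.1 y.1)) (t - j)%:~R else 1.

(* [d] is the sum of the indices of the prefix of [u] already read minus that
   of the prefix of [w] already read. *)
Fixpoint dual_fun (d : int) (w u : seq (B * int)) : k :=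
  match w, u with
  | [::], [::] => (d == 0)%:R
  | x :: w', y :: u' => (x.1 == y.1)%:R *
      (window_poly x w' (d + y.2) * dual_fun (d + y.2 - x.2) w' u')
  | _, _ => 0
  end.

(** At the first differing index the offset is still 0. If a letter follows, either the next letters
    differ or both words have the same window there, and [y.2] is a remaining root of the
    polynomial; at the last letter the final test on the offset fails. *)
Lemma dual_fun_eq0 (w u : seq (B * int)) :
  sorted in_window w -> sorted in_window u -> u != w -> dual_fun 0 w u = 0.
Proof.
elim: w u => [|x w IH] [|y u] //= wP uP uw.
have [exy|] := eqVneq x.1 y.1; last by rewrite mul0r.
rewrite mul1r add0r.
have [exy2|nxy2] := eqVneq y.2 x.2.
  have eyx : y = x by case: x y exy exy2 {wP uP uw} => ? ? [? ?] /= -> ->.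
  rewrite exy2 subrr IH ?mulr0 //; try exact: (path_sorted wP);
    try exact: (path_sorted uP).
  by apply: contraNneq uw => ->; rewrite eyx.
case: w wP {IH uw} => [|z w] /= wP; case: u uP => [|t u] /= uP;
  rewrite ?mulr0 ?subr_eq0 ?(negPf nxy2) ?mulr0 //.
have [ezt|] := eqVneq z.1 t.1; last by rewrite mul0r mulr0.
rewrite (big_rem y.2) ?subrr /=; first by rewrite !mul0r.
rewrite mem_rem_uniq ?window_uniq // inE nxy2 exy ezt.
by case/andP: uP.
Qed.

(** The value is a product of differences of distinct integers, nonzero in characteristic 0. *)
Lemma dual_fun_neq0 (w : seq (B * int)) : [pchar k] =i pred0 ->
  dual_fun 0 w w != 0.
Proof.
move=> char0; elim: w => [|x w IH] /=; first by rewrite oner_eq0.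
rewrite eqxx mul1r add0r subrr mulf_neq0 //.
case: w {IH} => [|y w] /=; first by rewrite oner_eq0.
rewrite prodf_seq_neq0; apply/allP => j /=.
rewrite mem_rem_uniq ?window_uniq // inE => /andP[jx _].
have : x.2 - j != 0 by rewrite subr_eq0 eq_sym.
move: (x.2 - j) => z z0.
by case: z z0 => n n0; rewrite ?NegzE ?mulrNz ?oppr_eq0 -pmulrn (pcharf0P _).1.
Qed.

(** Only the index sum of the prefix ending at [b] depends on [s], so a single factor varies, and
    [binomial_diff_prod] applies to it. *)
Lemma dual_fun_locality (d : int) (w u v : seq (B * int)) (b a : B)
    (m n : int) :
  sorted in_window w ->
  \sum_(s < (N b a).+1) ((-1) ^+ s * 'C(N b a, s)%:R) *
     dual_fun d w (u ++ [:: (b, n - s%:Z), (a, m + s%:Z) & v]) = 0.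
Proof.
elim: u d w => [|y u IH] d [|x w] //= wP.
- by rewrite big1 // => s _; rewrite mulr0.
- case: w wP => [|y w] /= wP; first by rewrite big1 // => s _; rewrite !mulr0.
  have [xb|] := eqVneq x.1 b; last first.
    by rewrite big1 // => s _; rewrite mul0r mulr0.
  have [ya|] := eqVneq y.1 a; last first.
    by rewrite big1 // => s _; rewrite mul0r !mulr0.
  set L := rem _ _.
  (* The node [x.2] lies in the window, so its removal leaves [N b a - 1] roots. *)
  have szL : (size L < N b a)%N.
    case/andP: wP => xin _; rewrite size_rem // size_map size_iota xb ya.
    by move: xin; rewrite in_windowE xb ya; lia.
  have := @binomial_diff_prod k L (N b a) (d + n) szL.
  (* The argument of the polynomial at [a]: the shifts by [s] have cancelled. *)
  set e := d + n - x.2 + m.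
  move=> /(congr1 (fun z => z * (window_poly y w e *
      dual_fun (e - y.2) w v))); rewrite mul0r mulr_suml; apply: etrans.
  apply: eq_bigr => s _; rewrite !mul1r !mulrA; congr (_ * _ * _ * _).
  + by apply: eq_bigr => j _; rewrite addrA.
  + by congr (window_poly _ _ _); rewrite /e; lia.
  + by congr (dual_fun _ _ _); rewrite /e; lia.
- by rewrite big1 // => s _; rewrite mulr0.
- have := IH (d + y.2 - x.2) w (path_sorted wP).
  move=> /(congr1 (fun z => (x.1 == y.1)%:R * (window_poly x w (d + y.2)) * z)).
  rewrite mulr0 mulr_sumr; apply: etrans.
  by apply: eq_bigr => s _; rewrite [RHS]mulrCA !mulrA.
Qed.

End SeparatingFunctional.

(** * Subspaces, spans and sums *)

Section Subspaces.
Variables (k : fieldType) (V : lmodType k).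
Implicit Types (S U : set V).

Lemma subspaceZ U (c : k) (x : V) : is_subspace U -> U x -> U (c *: x).
Proof. by case=> U0 Ulin Ux; rewrite -[_ *: _]addr0; apply: Ulin. Qed.

Lemma subspaceD U (x y : V) : is_subspace U -> U x -> U y -> U (x + y).
Proof. by case=> U0 Ulin Ux Uy; rewrite -[x]scale1r; apply: Ulin. Qed.

Lemma subspace_sum U (I : Type) (r : seq I) (P : pred I) (F : I -> V) :
  is_subspace U -> (forall i, P i -> U (F i)) -> U (\sum_(i <- r | P i) F i).
Proof.
move=> Usub UF; apply: big_ind => // [|x y]; first by case: Usub.
exact: subspaceD.
Qed.

Lemma linear_span_subspace S : is_subspace (linear_span S).
Proof.
split=> [|c x y [s [sS ->]] [t [tS ->]]].
  by exists [::]; rewrite big_nil.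
exists ([seq (c * p.1, p.2) | p <- s] ++ t); split=> [p|].
  by rewrite mem_cat => /orP[/mapP[q qs ->]|/tS//]; exact: (sS q).
rewrite big_cat big_map scaler_sumr; congr (_ + _).
by apply: eq_bigr => p _; rewrite scalerA.
Qed.

Lemma sub_linear_span S : S `<=` linear_span S.
Proof.
move=> x Sx; exists [:: (1, x)]; rewrite big_seq1 scale1r; split=> // p.
by rewrite mem_seq1 => /eqP->.
Qed.

Lemma linear_span_min S U : is_subspace U -> S `<=` U -> linear_span S `<=` U.
Proof.
move=> Usub SU x [s [sS ->]]; rewrite big_seq_cond.
by apply: subspace_sum => // p /andP[ps _]; apply: subspaceZ (SU _ (sS _ ps)).
Qed.

(** One rewriting step: a locality relation is solved for one of its extreme terms. *)
Lemma subspace_solve U (n : nat) (c : 'I_n -> k) (F : 'I_n -> V) (i0 : 'I_n) :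
  is_subspace U -> c i0 != 0 -> \sum_(i < n) c i *: F i = 0 ->
  (forall i, i != i0 -> U (F i)) -> U (F i0).
Proof.
move=> Usub c0 sum0 UF; rewrite -[F i0]scale1r -(mulVf c0) -scalerA.
apply: subspaceZ => //; move: sum0; rewrite (bigD1 i0) //= => /eqP.
rewrite addr_eq0 => /eqP->; rewrite -scaleN1r; apply: subspaceZ => //.
by apply: subspace_sum => // i /UF; apply: subspaceZ.
Qed.

End Subspaces.

Section NonunitalSums.
Variables (k : fieldType) (A : nualgType k).

Lemma numul0r (x : A) : (0 : A) ** x = 0.
Proof. by rewrite -(scale0r (0 : A)) -nuscaleAl !scale0r. Qed.

Lemma numulr0 (x : A) : x ** (0 : A) = 0.
Proof. by rewrite -(scale0r (0 : A)) -nuscaleAr !scale0r. Qed.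

Lemma numul_suml (I : Type) (r : seq I) (P : pred I) (F : I -> A) (x : A) :
  (\sum_(i <- r | P i) F i) ** x = \sum_(i <- r | P i) F i ** x.
Proof.
by apply: (big_morph (fun y => y ** x) (fun y z => numulDl y z x) (numul0r x)).
Qed.

Lemma subspace_lmul (U : set A) (x : A) :
  is_subspace U -> is_subspace [set y | U (x ** y)].
Proof.
case=> U0 Ulin; split=> [|c y z Uy Uz] /=; first by rewrite numulr0.
by rewrite numulDr -nuscaleAr; apply: Ulin.
Qed.

Lemma subspace_rmul (U : set A) (x : A) :
  is_subspace U -> is_subspace [set y | U (y ** x)].
Proof.
case=> U0 Ulin; split=> [|c y z Uy Uz] /=; first by rewrite numul0r.
by rewrite numulDl -nuscaleAl; apply: Ulin.
Qed.

End NonunitalSums.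

(** * Words and functionals on the free algebra *)

Section FreeWords.
Variables (k : fieldType) (X : choiceType).
Local Notation kX := {malg k[{fmonom X}]}.
Implicit Types (w : X * seq X).

Definition free_word w : free_nualg k X :=
  foldl (fun p x => p ** free_gen k x) (free_gen k w.1) w.2.

Lemma malgUZ (c : k) (u : {fmonom X}) : << c *g u >> = c *: << u >> :> kX.
Proof.
apply/malgP => v; rewrite mcoeffZ [LHS]mcoeffU [X in _ = _ * X]mcoeffU.
by rewrite mulrnAr mulr1. Qed.

Lemma malg_mulU (c d : k) (u v : {fmonom X}) :
  << c *g u >> * << d *g v >> = << c * d *g mmul u v >> :> kX.
Proof.
rewrite (malgMEw msuppU_le msuppU_le) !finmap.big_seq_fset1.
by rewrite !mcoeffUU.
Qed.

Lemma free_val_word w : free_val (free_word w) = << FMonom (w.1 :: w.2) >>.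
Proof.
rewrite /free_word; case: w => x s /=.
elim/last_ind: s => [|s y IH]; first by rewrite /= fmuE.
rewrite -cats1 foldl_cat /= IH malg_mulU mulr1; congr (<< _ *g _ >>).
by apply: val_inj => /=; rewrite fmM fmU.
Qed.

Lemma free_val_sum (I : Type) (r : seq I) (P : pred I)
    (F : I -> free_nualg k X) :
  free_val (\sum_(i <- r | P i) F i) = \sum_(i <- r | P i) free_val (F i).
Proof. by apply: (big_morph (@free_val k X)). Qed.

(** An element of the augmentation ideal has no constant term, so discarding the empty word loses
    nothing. *)
Lemma free_word_sum (x : free_nualg k X) :
  exists s : seq (k * (X * seq X)), x = \sum_(p <- s) p.1 *: free_word p.2.
Proof.
pose good (u : {fmonom X}) := fmonom_val u != [::].
pose letters (u : {fmonom X}) : option (k * (X * seq X)) :=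
  if fmonom_val u is y :: t then Some ((free_val x)@_u, (y, t)) else None.
exists (pmap letters (finmap.enum_fset (msupp (free_val x)))).
apply: val_inj; rewrite /= free_val_sum [LHS]monalgE.
have : {subset finmap.enum_fset (msupp (free_val x)) <= good}.
  move=> u; rewrite -[_ \in _]mcoeff_neq0; apply: contraNneq => u0.
  have -> : u = mone by apply: val_inj; rewrite /= fm1.
  by have := valP x; rewrite unfold_in.
elim: (finmap.enum_fset _) => [|u r IH] sub; first by rewrite !big_nil.
rewrite big_cons IH => [|v vr]; last by apply: sub; rewrite inE vr orbT.
have := sub u (mem_head _ _); rewrite unfold_in /good /=.
case eu: (fmonom_val u) => [|y t] //= _.
have -> : letters u = Some ((free_val x)@_u, (y, t)) by rewrite /letters eu.
rewrite big_cons /= free_val_word; congr (_ + _).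
by rewrite -eu malgUZ; case: u {sub eu}.
Qed.

Definition word_eval (f : seq X -> k) (x : kX) : k :=
  mmap idfun (fun u : {fmonom X} => f u) x.

Lemma word_evalU (f : seq X -> k) (c : k) (u : {fmonom X}) :
  word_eval f << c *g u >> = c * f u.
Proof. exact: mmapU. Qed.

Lemma word_eval_sum (f : seq X -> k) (I : Type) (r : seq I) (P : pred I)
    (F : I -> kX) :
  word_eval f (\sum_(i <- r | P i) F i) = \sum_(i <- r | P i) word_eval f (F i).
Proof. exact: raddf_sum. Qed.

Lemma word_evalD (f : seq X -> k) : {morph word_eval f : x y / x + y}.
Proof. exact: mmapD. Qed.

Fact malg_scaleAl (c : k) (x y : kX) : c *: (x * y) = (c *: x) * y.
Proof. exact: scalerAl. Qed.

Lemma word_evalZ (f : seq X -> k) (c : k) (x : kX) :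
  word_eval f (c *: x) = c * word_eval f x.
Proof.
rewrite /word_eval (mmapEw (msuppZ_le _ _)) mmapE mulr_sumr.
by apply: eq_bigr => u _; rewrite /= mcoeffZ mulrA.
Qed.

(** The largest ideal on which the functional vanishes; [y] and [z] range over the unital algebra,
    so that either may be 1. *)
Definition two_sided_kernel (f : seq X -> k) : set (free_nualg k X) :=
  [set x | forall y z : kX, word_eval f (y * free_val x * z) = 0].

Lemma two_sided_kernel_ideal (f : seq X -> k) : is_ideal (two_sided_kernel f).
Proof.
split; first split=> [y z|c x1 x2 K1 K2 y z].
- by rewrite /= mulr0 mul0r /word_eval mmap0.
- rewrite /= mulrDr mulrDl word_evalD -malg_scaleAr -malg_scaleAl word_evalZ.
  have /= := f_equal2 (fun s t => c * s + t) (K1 y z) (K2 y z).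
  by rewrite mulr0 addr0.
- move=> a x K; split=> y z /=.
    by rewrite mulrA; apply: (K (y * free_val a) z).
  rewrite (mulrA y) -(mulrA _ (free_val a)).
  exact: (K y (free_val a * z)).
Qed.

Lemma two_sided_kernelP (f : seq X -> k) (x : free_nualg k X) :
  (forall u v : {fmonom X}, word_eval f (<< u >> * free_val x * << v >>) = 0) ->
  two_sided_kernel f x.
Proof.
move=> Kx y z; rewrite -mulrA {1}[y]monalgE mulr_suml word_eval_sum.
rewrite big1 // => u _.
rewrite mulrA {1}[z]monalgE mulr_sumr word_eval_sum big1 // => v _.
rewrite (malgUZ y@_u) (malgUZ z@_v) -malg_scaleAr -!malg_scaleAl !word_evalZ.
by rewrite (Kx u v) !mulr0.
Qed.

End FreeWords.

(** * Monomials in the coefficient algebra and their independence *)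

Section CoefficientAlgebra.
Variables (k : fieldType) (B : choiceType) (N : B -> B -> nat).
Local Notation A := (Coeff k N).
Local Notation rels := (@locality_rels k B N).
Local Notation X := (B * int)%type.
Implicit Types (x y : X) (s t : seq X) (w : X * seq X).

Lemma quot_pi0 : quot_pi rels 0 = 0 :> A.
Proof.
rewrite -(scale0r (0 : free_nualg k X)) quot_piZ.
exact: (@scale0r k A).
Qed.

Lemma quot_pi_sum (I : Type) (r : seq I) (c : I -> k)
    (F : I -> free_nualg k X) :
  quot_pi rels (\sum_(i <- r) c i *: F i) =
  \sum_(i <- r) c i *: (quot_pi rels (F i) : A).
Proof.
elim: r => [|i r IH]; last by rewrite !big_cons quot_piD quot_piZ IH.
by rewrite !big_nil quot_pi0.
Qed.

Lemma monomialE w : monomial k N w = quot_pi rels (free_word k w).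
Proof.
case: w => x s; rewrite /monomial /free_word /=.
elim/last_ind: s => [|s y IH] //=.
by rewrite -cats1 !foldl_cat /= IH [RHS]quot_piM.
Qed.

Lemma monomial_cons x y s :
  monomial k N (x, y :: s) = gen k N x ** monomial k N (y, s).
Proof.
rewrite /monomial /=; elim/last_ind: s => [|s z IH] //=.
by rewrite -cats1 !foldl_cat /= IH numulA.
Qed.

Lemma monomial_mul x y s t :
  monomial k N (x, s) ** monomial k N (y, t) = monomial k N (x, s ++ y :: t).
Proof.
elim: s x => [|z s IH] x; first by rewrite /= monomial_cons.
by rewrite /= !monomial_cons -numulA IH.
Qed.

Lemma monomial_span (a : A) :
  exists s : seq (k * (X * seq X)), a = \sum_(p <- s) p.1 *: monomial k N p.2.
Proof.
have [x ->] := quot_piK a; have [s ->] := free_word_sum x.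
by exists s; rewrite quot_pi_sum; apply: eq_bigr => p _; rewrite monomialE.
Qed.

Lemma locality (b a : B) (n m : int) s :
  \sum_(i < (N b a).+1) ((-1) ^+ i * 'C(N b a, i)%:R : k) *:
    (gen k N (b, n - i%:Z) ** monomial k N ((a, m + i%:Z), s)) = 0.
Proof.
have loc : \sum_(i < (N b a).+1) ((-1) ^+ i * 'C(N b a, i)%:R : k) *:
    (gen k N (b, n - i%:Z) ** gen k N (a, m + i%:Z)) = 0 :> A.
  rewrite -[RHS]quot_pi0; have -> : quot_pi rels 0 =
            quot_pi rels (@locality_rel k B N b a m n).
    apply/esym/quot_piP; rewrite subr0.
    by move=> S [_]; apply; exists b, a, m, n.
  rewrite /locality_rel quot_pi_sum; apply: eq_bigr => i _.
  by rewrite [in RHS]quot_piM.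
case: s => [|y s] //.
have := congr1 (fun z : A => z ** monomial k N (y, s)) loc.
rewrite numul0r numul_suml; apply: etrans; apply: eq_bigr => i _.
by rewrite monomial_cons numulA nuscaleAl.
Qed.

Section Independence.
Variable lo : B -> B -> int.
Local Notation normal := (sorted (in_window N lo)).

(** By minimality of the generated ideal it is enough to test the relations between arbitrary words
    [u] and [v], which is [dual_fun_locality]. *)
Lemma gen_ideal_dual_fun (d : int) s (a : free_nualg k X) :
  normal s -> gen_ideal rels a ->
  two_sided_kernel (dual_fun k N lo d s) a.
Proof.
move=> sP; apply; split; first exact: two_sided_kernel_ideal.
move=> _ [b [c [m [n ->]]]]; apply: two_sided_kernelP => u v.
rewrite free_val_sum mulr_sumr mulr_suml word_eval_sum.
have := @dual_fun_locality k B N lo d s u v b c m n sP.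
apply: etrans; apply: eq_bigr => i _.
rewrite /= malg_mulU -malg_scaleAr -malg_scaleAl word_evalZ.
rewrite !malg_mulU word_evalU !mulr1 mul1r; congr (_ * dual_fun _ _ _ _ _ _).
by rewrite !fmM !fmU -!catA.
Qed.

Lemma normal_monomial_free (r : seq (X * seq X)) (c : X * seq X -> k) :
  [pchar k] =i pred0 -> uniq r -> all (fun w => normal (w.1 :: w.2)) r ->
  \sum_(w <- r) c w *: monomial k N w = 0 -> forall w, w \in r -> c w = 0.
Proof.
move=> char0 r_uniq /allP rP sum0 w wr.
(* The combination is lifted to the free algebra, where the functional of [w] kills it and, on the
   words of [r], is nonzero at [w] only. *)
pose a := \sum_(v <- r) c v *: free_word k v.
have a0 : gen_ideal rels a.
  rewrite -[a]subr0; apply/quot_piP; rewrite /a quot_pi_sum.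
  rewrite quot_pi0 -[RHS]sum0.
  by apply: eq_bigr => v _; rewrite monomialE.
have := gen_ideal_dual_fun 0 (rP _ wr) a0.
have fw := dual_fun_neq0 N lo (w.1 :: w.2) char0.
have fv v : v \in r -> v != w ->
    dual_fun k N lo 0 (w.1 :: w.2) (v.1 :: v.2) = 0.
  move=> vr vw; apply: dual_fun_eq0; [exact: rP | exact: rP |].
  by apply: contraNneq vw; case: v w {wr vr fw} => [? ?] [? ?] /= [-> ->].
move: (dual_fun _ _ _ _ _) fw fv => f fw fv.
(* Trivial multipliers recover the functional itself. *)
move=> /(_ 1 1); rewrite mul1r mulr1 free_val_sum word_eval_sum.
rewrite (bigD1_seq w) //= big_seq_cond big1 => [|v /andP[vr vw]].
  rewrite addr0 word_evalZ free_val_word word_evalU mul1r => /eqP.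
  by rewrite mulf_eq0 (negPf fw) orbF => /eqP.
by rewrite word_evalZ free_val_word word_evalU mul1r /= fv ?mulr0.
Qed.

End Independence.

End CoefficientAlgebra.

(** * Reduction to normal words *)

Section Spanning.
Variables (k : fieldType) (B : choiceType) (N : B -> B -> nat).
Local Notation A := (Coeff k N).
Local Notation X := (B * int)%type.
(** [Z] holds the admissible indices: all integers for A, the nonnegative ones for the positive
    subalgebra. Reducing from above only raises the next index, whence [Z_up]; reducing from below
    lowers it without bound, whence [Z_below]. *)
Variables (lo : B -> B -> int) (Z : pred int).
Hypothesis Z_up : forall n (i : nat), Z n -> Z (n + i%:Z).
Hypothesis Z_below : forall b a n, Z n -> n < lo b a -> forall m, Z m.

Definition normal_word (w : X * seq X) : bool :=
  sorted (in_window N lo) (w.1 :: w.2) && Z (last w.1 w.2).2.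

(* Fixing the first letter is what lets a reduction of the tail be extended on
   the left without a new case distinction. *)
Definition normal_span_from (b : B) : set A :=
  linear_span (monomial k N @` [set w | normal_word w /\ w.1.1 = b]).

Lemma normal_span_from_subspace b : is_subspace (normal_span_from b).
Proof. exact: linear_span_subspace. Qed.

Lemma normal_span_from_cons (b a : B) (n : int) (x : A) :
  in_window N lo (b, n) (a, 0) -> normal_span_from a x ->
  normal_span_from b (gen k N (b, n) ** x).
Proof.
move=> bn; apply: (linear_span_min
  (subspace_lmul _ (normal_span_from_subspace b))).
move=> _ [[[c m] s] [/andP[/= sP lP] /= ca] <-] /=.
rewrite -monomial_cons; apply: sub_linear_span.
exists ((b, n), (c, m) :: s) => //=; split=> //.
by rewrite /normal_word /= sP lP !andbT; move: bn; rewrite !in_windowE /= ca.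
Qed.

(** Induction on the word: the first index is moved into its window at the cost of changing the
    second, and then the tail is reduced, which keeps its first letter and hence the window. *)
Lemma reduce_monomial (x : X) (s : seq X) :
  all (fun y => Z y.2) (x :: s) -> normal_span_from x.1 (monomial k N (x, s)).
Proof.
elim: s x => [|[a m] s IH] [b n] /=.
  by rewrite andbT => Zn; apply: sub_linear_span; exists ((b, n), [::]) => //=.
move=> /and3P[Zn Zm Zs]; rewrite monomial_cons.
have tailP m' : Z m' -> normal_span_from a (monomial k N ((a, m'), s)).
  by move=> Zm'; apply: (IH (a, m')); rewrite /= Zm' Zs.
pose P n' m' :=
  normal_span_from b (gen k N (b, n') ** monomial k N ((a, m'), s)).
pose l := lo b a; pose M := N b a.
have Pwin n' m' : Z m' -> l <= n' < l + M%:Z -> P n' m'.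
  move=> Zm' n'P; apply: normal_span_from_cons (tailP _ Zm').
  by rewrite in_windowE.
(* Solving for the term [i = 0] lowers [n'] by between 1 and [M], so it never drops below [l]. For
   [M = 0] the relation has no other term and the product is zero. *)
have Pup (j : nat) n' m' : Z m' -> l <= n' < l + M%:Z + j%:Z -> P n' m'.
  elim: j n' m' => [|j IHj] n' m' Zm' n'P.
    by apply: Pwin => //; rewrite addr0 in n'P.
  have [n'M|Mn'] := ltP n' (l + M%:Z); first by apply: Pwin => //; lia.
  have := @subspace_solve k A (normal_span_from b) _ _ _ ord0
    (normal_span_from_subspace b) _ (locality k N b a n' m' s).
  rewrite /= subr0 addr0; apply; first by rewrite bin0 mul1r oner_eq0.
  move=> i i0; apply: IHj; first exact: Z_up.
  have := ltn_ord i; move: i0; rewrite -val_eqE /=.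
  by rewrite /M in Mn' n'P *; lia.
have Pge n' m' : Z m' -> l <= n' -> P n' m'.
  by move=> Zm' ln'; apply: (Pup `|n' - l|.+1) => //; lia.
have [ln|nl] := leP l n; first exact: Pge.
have Zall := Z_below Zn nl.
have Pdown (j : nat) n' m' : l <= n' + j%:Z -> P n' m'.
  elim: j n' m' => [|j IHj] n' m' n'P.
    by apply: Pge => //; rewrite addr0 in n'P.
  (* The relation is shifted by [M] so that its last term is the product at [n'] and [m']; all other
     terms have a larger first index. *)
  have := @subspace_solve k A (normal_span_from b) _ _ _ ord_max
    (normal_span_from_subspace b) _
    (locality k N b a (n' + M%:Z) (m' - M%:Z) s).
  rewrite /= addrK subrK; apply; first by rewrite binn mulr1 signr_eq0.
  move=> i iM; apply: IHj.
  by have := ltn_ord i; move: iM; rewrite -val_eqE /= -/M; lia.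
by apply: (Pdown `|l - n|%N); lia.
Qed.

Lemma reduce_monomial_span (w : X * seq X) :
  all (fun y => Z y.2) (w.1 :: w.2) ->
  linear_span (monomial k N @` [set w | normal_word w]) (monomial k N w).
Proof.
case: w => x s /reduce_monomial; apply: linear_span_min.
  exact: linear_span_subspace.
by move=> _ [w [wP _] <-]; apply: sub_linear_span; exists w.
Qed.

End Spanning.

(** * The two index ranges, and the positive subalgebra as a span of nonnegative words *)

Section PositiveSubalgebra.
Variables (k : fieldType) (B : choiceType) (N : B -> B -> nat).
Local Notation A := (Coeff k N).
Local Notation X := (B * int)%type.

Definition nonneg_word (w : X * seq X) : bool :=
  all (fun y => 0 <= y.2) (w.1 :: w.2).

Lemma balanced_wordE (w : X * seq X) :
  balanced_word N w =
  normal_word N (fun x y => - Num.ceil (((N x y)%:R - 1) / 2 : rat)) xpredT w.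
Proof.
rewrite /balanced_word /normal_word /= andbT; apply: eq_path => x y.
rewrite in_windowE; set n := N _ _.
(* The floor and the ceiling of [(n - 1) / 2] add up to [n - 1], so the balanced range has exactly
   [n] integers. *)
have -> : Num.floor ((n%:R - 1) / 2 : rat) =
    n%:Z - 1 - Num.ceil ((n%:R - 1) / 2 : rat).
  have := odd_double_half n; case: (odd n) => /= <-; set j := (_./2)%N.
    have -> : ((1 + j.*2)%:R - 1) / 2 = (j%:Z)%:~R :> rat.
      by rewrite -pmulrn natrD -muln2 natrM; field.
    by rewrite intrKfloor intrKceil; lia.
  rewrite add0n (floor_def (m := j%:Z - 1)).
    rewrite (ceil_def (m := j%:Z)); first lia.
    by rewrite intrB -pmulrn -muln2 natrM; lra.
  by rewrite subrK intrB -pmulrn -muln2 natrM; lra.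
by congr (_ && _); lia.
Qed.

Lemma positive_wordE (w : X * seq X) :
  positive_word N w = normal_word N (fun _ _ => 0) (fun n => 0 <= n) w.
Proof.
rewrite /positive_word /normal_word /=; congr (_ && _); apply: eq_path => x y.
by rewrite in_windowE; congr (_ && _); lia.
Qed.

Lemma positive_word_nonneg (w : X * seq X) : positive_word N w -> nonneg_word w.
Proof.
case: w => x s; rewrite /positive_word /nonneg_word /=.
elim: s x => [|y s IH] x /=; first by rewrite andbT.
by move=> /andP[/andP[/andP[-> _] sP] lP]; apply: IH; rewrite sP lP.
Qed.

Lemma Coeff_pos_subspace : is_subspace (Coeff_pos k N).
Proof. exact: linear_span_subspace. Qed.

(* By induction on [n]: [(a o_n c)(m)] is [a(n) c(m)] plus a combination of the
   [a(n - i) c(m + i)] with [0 < i <= n]. *)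
Lemma Coeff_pos_mul (a c : int -> A) (n : nat) (m : int) :
  free_conformal k N a -> free_conformal k N c -> 0 <= m ->
  Coeff_pos k N (a n%:Z ** c m).
Proof.
move=> aC cC; elim/ltn_ind: n m => n IH m m0.
have circP : Coeff_pos k N (circ n a c m).
  apply: sub_linear_span; exists (circ n a c), m; split=> // S SP.
  by have [[_ _ Scirc] _] := SP; apply: Scirc; [apply: aC | apply: cC].
have -> : a n%:Z ** c m = circ n a c m + (-1 : k) *: \sum_(i < n)
    ((-1) ^+ i.+1 * 'C(n, i.+1)%:R : k) *:
    (a (n%:Z - i.+1%:Z) ** c (m + i.+1%:Z)).
  rewrite /circ big_ord_recl /= bin0 mulr1 scale1r subr0 addr0.
  by rewrite scaleN1r addrK.
have sub := Coeff_pos_subspace; apply: subspaceD => //; apply: subspaceZ => //.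
apply: subspace_sum => // i _; apply: subspaceZ => //.
rewrite subzn //; apply: IH; [by have := ltn_ord i; lia | lia].
Qed.

(** Generators are prepended one at a time; by linearity the tail may be taken to be a single
    coefficient [c m], and [Coeff_pos_mul] applies. *)
Lemma nonneg_monomial_Coeff_pos (w : X * seq X) :
  nonneg_word w -> Coeff_pos k N (monomial k N w).
Proof.
have genC b : free_conformal k N (gen_series k N b).
  by move=> S [_]; apply; exists b.
case: w => x s; rewrite /nonneg_word.
elim: s x => [|y s IH] [b n] /= /andP[n0 sP].
  by apply: sub_linear_span; exists (gen_series k N b), n; split.
rewrite monomial_cons; move: (IH y sP); apply: (linear_span_min
  (subspace_lmul _ Coeff_pos_subspace)).
move=> _ [c [m [cC m0 ->]]] /=; case: n n0 => // n _.
exact: (Coeff_pos_mul n (genC b)).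
Qed.

(** The series whose nonnegative coefficients all lie in the span form a conformally closed set
    containing the generators, hence contain the free conformal algebra. *)
Lemma Coeff_pos_nonneg_span :
  Coeff_pos k N `<=`
  linear_span (monomial k N @` [set w | nonneg_word w]).
Proof.
set U := linear_span _.
have Usub : is_subspace U by apply: linear_span_subspace.
have Umul (x y : A) : U x -> U y -> U (x ** y).
  move=> Ux Uy; move: x Ux; apply: (linear_span_min (subspace_rmul y Usub)).
  move=> _ [[x s] wP <-] /=; move: y Uy.
  apply: (linear_span_min (subspace_lmul _ Usub)) => _ [[y t] vP <-] /=.
  rewrite monomial_mul; apply: sub_linear_span; eexists; last by [].
  by move: wP vP; rewrite /= /nonneg_word /= all_cat /= => /andP[-> ->].
apply: linear_span_min => // _ [c [n [cC n0 ->]]].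
move: n n0; apply: (cC [set c | forall n, 0 <= n -> U (c n)]).
split; last first.
  move=> _ [b _ <-] n n0; apply: sub_linear_span.
  by exists ((b, n), [::]) => //=; rewrite /nonneg_word /= n0.
split; first split=> [n _|d x y Ux Uy n n0].
- by case: Usub.
- by case: Usub => _; apply; [apply: Ux | apply: Uy].
(* At [m = 0] the derivative involves the index -1, but with coefficient 0. *)
- move=> a Ua m m0; rewrite /fd_deriv; have [->|mn0] := eqVneq m 0.
    by rewrite oppr0 mulr0z; case: Usub.
  by rewrite -(@scaler_int k); apply: subspaceZ => //; apply: Ua; lia.
- move=> n a b Ua Ub m m0; apply: subspace_sum => // i _.
  apply: subspaceZ => //.
  by apply: Umul; [apply: Ua | apply: Ub]; have := ltn_ord i; lia.
Qed.

End PositiveSubalgebra.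

(** * The two bases *)

Unset Implicit Arguments.

Theorem mainTheorem3 (k : fieldType) (char0 : [pchar k] =i pred0)
    (B : choiceType) (N : B -> B -> nat) :
  is_basis [set: Coeff k N] (balanced_word N) (monomial k N) /\
  is_basis (Coeff_pos k N) (positive_word N) (monomial k N).
Proof.
have indep (P : pred ((B * int) * seq (B * int))) lo Z :
    P =1 normal_word N lo Z -> forall (s : seq _) (c : _ -> k),
    uniq s -> all P s -> \sum_(i <- s) c i *: monomial k N i = 0 ->
    forall i, i \in s -> c i = 0.
  move=> PE s c s_uniq sP; apply: (@normal_monomial_free k B N lo) => //.
  by apply: sub_all sP => w; rewrite PE => /andP[].
split; split.
- apply/seteqP; split=> // a _; have [s ->] := monomial_span a.
  apply: subspace_sum => [|p _]; first exact: linear_span_subspace.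
  apply: subspaceZ; first exact: linear_span_subspace.
  rewrite (_ : [set i | _] = [set w | normal_word N
    (fun x y => - Num.ceil (((N x y)%:R - 1) / 2 : rat)) xpredT w]).
    by apply: reduce_monomial_span => //; apply/allP.
  by apply/seteqP; split=> w /=; rewrite balanced_wordE.
- by apply: indep; apply: balanced_wordE.
- apply/seteqP; split.
    apply: subset_trans (@Coeff_pos_nonneg_span k B N) _.
    apply: linear_span_min; first exact: linear_span_subspace.
    move=> _ [w wP <-].
    rewrite (_ : [set i | _] = [set w | normal_word N (fun _ _ => 0)
      (fun n => 0 <= n) w]); last first.
      by apply/seteqP; split=> v /=; rewrite positive_wordE.
    (* With windows starting at 0 no admissible index lies below a window, so [Z_below] holds
       vacuously. *)
    by apply: reduce_monomial_span wP => // [n i|_ _ n]; lia.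
  apply: linear_span_min; first exact: Coeff_pos_subspace.
  move=> _ [w /= wP <-]; apply: nonneg_monomial_Coeff_pos.
  exact: positive_word_nonneg wP.
- by apply: indep; apply: positive_wordE.
Qed.
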